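(* Let $m,n\in\mathbb{N}$, $0<\gamma<mn$, $\delta\in\mathbb{R}$, let $\vec p=(p_1,\dots,p_m)$ with $1\le p_i\le\infty$ be a vector of exponents, and let $1/p=\sum_{i=1}^m1/p_i$. Let $w$ be a weight and $\vec v=(v_1,\dots,v_m)$, where each $v_i$ is either a weight or is equal to $\infty$ almost everywhere. The following statements hold: (a) If $\delta>1$ or $\delta>\gamma-n/p$, then $(w,\vec v)$ satisfies condition $\mathcal{H}_m(\vec p,\gamma,\delta)$ if and only if $v_i=\infty$ a.e. for some $1\le i\le m$. (b) The same conclusion holds if $\delta=\gamma-n/p=1$; that is, in that case $(w,\vec v)$ satisfies condition $\mathcal{H}_m(\vec p,\gamma,\delta)$ if and only if $v_i=\infty$ a.e. for some $1\le i\le m$.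
   Context: A weight is a positive (a.e.) locally integrable function on $\mathbb{R}^n$; it is also assumed that $w^{-1}$ is locally integrable. If $v_i=\infty$ a.e. then $v_i^{-1}=0$ a.e.; the convention $0\cdot\infty=0$ is used in products. For a ball $B$, $w^{-1}(B)=\int_B w^{-1}$, $|B|$ is Lebesgue measure and $x_B$ is the center of $B$. $p_i'$ is the conjugate exponent of $p_i$ ($p_i'=1$ if $p_i=\infty$), and $n/p=0$ if $p=\infty$. Condition $\mathcal{H}_m(\vec p,\gamma,\delta)$: for some numbers $\gamma_1,\dots,\gamma_m$ with $0<\gamma_i<n$ and $\sum_{i=1}^m\gamma_i=\gamma$, there is $C>0$ such that for every ball $B\subset\mathbb{R}^n$ $$\frac{|B|^{1+(1-\delta)/n}}{w^{-1}(B)}\prod_{i=1}^m\left(\int_{\mathbb{R}^n}\frac{v_i^{-p_i'}(y)}{(|B|^{1/n}+|x_B-y|)^{(n-\gamma_i+1/m)p_i'}}\,dy\right)^{1/p_i'}\le C,$$ where for each $i$ with $p_i=1$ the $i$-th factor is understood as $\left\|\frac{v_i^{-1}}{(|B|^{1/n}+|x_B-\cdot|)^{n-\gamma_i+1/m}}\right\|_\infty$. *)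

(* Defs.v *)
From HB Require Import structures.
From mathcomp Require Import all_boot all_order all_algebra.
From mathcomp Require Import all_classical all_reals all_analysis measurable_realfun.

Set Implicit Arguments.
Unset Strict Implicit.
Unset Printing Implicit Defensive.

Import Order.TTheory GRing.Theory Num.Theory.
Import numFieldNormedType.Exports.

Local Open Scope classical_set_scope.
Local Open Scope ring_scope.

(* Lebesgue measure on R^n = 'rV[R]_n is obtained in two steps: the product of
   n copies of the one-dimensional Lebesgue measure, defined on the Borel sets
   by recursion on n, is then completed by Caratheodory's construction, so that
   "measurable" means "Lebesgue measurable". *)

Definition rV_cylinder (R : realType) (n : nat) : set (set 'rV[R]_n) :=
  [set A | exists i : 'I_n, exists2 B : set (measurableTypeR R),
     measurable B & A = [set x : 'rV[R]_n | B (x 0 i)]].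

Definition rV_borel (R : realType) (n : nat) :=
  g_sigma_algebraType (@rV_cylinder R n).
HB.instance Definition _ (R : realType) (n : nat) :=
  Measurable.on (rV_borel R n).

Section product_lebesgue.
Variable R : realType.

Definition rV_cons (n : nat) (p : measurableTypeR R * rV_borel R n) :
    rV_borel R n.+1 :=
  \row_(j < n.+1) (if unlift ord0 j is Some k then p.2 0 k else p.1).

Definition rV_uncons (n : nat) (x : rV_borel R n.+1) :
    measurableTypeR R * rV_borel R n :=
  (x 0 ord0, \row_(k < n) x 0 (lift ord0 k)).

Lemma rV_consK (n : nat) : cancel (@rV_cons n) (@rV_uncons n).
Proof.
move=> [a v]; rewrite /rV_uncons /rV_cons; congr pair.
  by rewrite mxE unlift_none.
by apply/rowP => k; rewrite !mxE liftK.
Qed.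

Lemma measurable_rV_coord (n : nat) (i : 'I_n) :
  measurable_fun [set: rV_borel R n]
    (fun x : rV_borel R n => x 0 i : measurableTypeR R).
Proof.
move=> _ B mB; rewrite setTI; apply: sub_sigma_algebra.
by exists i, B.
Qed.

Lemma measurable_fun_rV d (T : measurableType d) (n : nat)
    (f : T -> rV_borel R n) :
  (forall i, measurable_fun [set: T] (fun t => f t 0 i : measurableTypeR R)) ->
  measurable_fun [set: T] f.
Proof.
move=> mf; refine (@measurability _ _ T (rV_borel R n) setT f _ erefl _).
by move=> _ [_ [i [B mB ->]] <-]; exact: mf.
Qed.

Lemma measurable_rV_cons (n : nat) : measurable_fun [set: _] (@rV_cons n).
Proof.
apply: measurable_fun_rV => i; rewrite /rV_cons.
case: (unliftP ord0 i) => [k ->|->].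
  under eq_fun do rewrite mxE liftK.
  exact: (measurableT_comp (@measurable_rV_coord n k)).
under eq_fun do rewrite mxE unlift_none.
exact: measurable_fst.
Qed.

Lemma measurable_rV_uncons (n : nat) : measurable_fun [set: _] (@rV_uncons n).
Proof.
apply/measurable_fun_pairP; split; first exact: measurable_rV_coord.
apply: measurable_fun_rV => i.
rewrite (_ : (fun _ => _) = fun x : rV_borel R n.+1 => x 0 (lift ord0 i)).
  exact: measurable_rV_coord.
by apply/funext => x /=; rewrite mxE.
Qed.

Section step.
Variables (n : nat) (m : {sigma_finite_measure set (rV_borel R n) -> \bar R}).

Definition lebesgue_cons : set (rV_borel R n.+1) -> \bar R :=
  pushforward (@lebesgue_measure R \x m)%E (@rV_cons n).

Let lebesgue_cons0 : lebesgue_cons set0 = 0%E.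
Proof. by rewrite /lebesgue_cons /pushforward preimage_set0 measure0. Qed.

Let lebesgue_cons_ge0 A : (0 <= lebesgue_cons A)%E.
Proof. by rewrite /lebesgue_cons /pushforward; exact: measure_ge0. Qed.

Let lebesgue_cons_sigma_additive : semi_sigma_additive lebesgue_cons.
Proof.
move=> F mF tF mUF; rewrite /lebesgue_cons /pushforward preimage_bigcup.
have mc := @measurable_rV_cons n.
apply: measure_semi_sigma_additive.
- by move=> k; rewrite -[X in measurable X]setTI; exact: mc.
- apply/trivIsetP => /= i j _ _ ij; rewrite -preimage_setI.
  by move/trivIsetP : tF => /(_ _ _ _ _ ij) ->//; rewrite preimage_set0.
- by rewrite -preimage_bigcup -[X in measurable X]setTI; exact: mc.
Qed.

HB.instance Definition _ := isMeasure.Build _ _ _ lebesgue_cons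
  lebesgue_cons0 lebesgue_cons_ge0 lebesgue_cons_sigma_additive.

Let lebesgue_cons_sigma_finite : sigma_finite [set: _] lebesgue_cons.
Proof.
have /sigma_finiteP[F [FT ndF Foo]] := sigma_finiteT (@lebesgue_measure R).
have /sigma_finiteP[G [GT ndG Goo]] := sigma_finiteT m.
exists (fun k => @rV_uncons n @^-1` (F k `*` G k)).
  rewrite -preimage_bigcup -[LHS](preimage_setT (@rV_uncons n)).
  congr (_ @^-1` _); rewrite -setXTT FT GT predeqE => -[x y]; split.
    move=> [/= [j _ Fjx] [k _ Gky]]; exists (maxn j k) => //; split.
    - by move: x Fjx; exact/subsetPset/ndF/leq_maxl.
    - by move: y Gky; exact/subsetPset/ndG/leq_maxr.
  by move=> [j _ []/= ? ?]; split; exists j.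
move=> k; have [mF Fk] := Foo k; have [mG Gk] := Goo k; split.
  rewrite -[X in measurable X]setTI.
  by apply: measurable_rV_uncons => //; exact: measurableX.
rewrite /lebesgue_cons /pushforward -comp_preimage.
rewrite (_ : _ \o _ = idfun) ?preimage_id; last first.
  by apply/funext => p /=; exact: rV_consK.
by rewrite product_measure1E// lte_mul_pinfty// ge0_fin_numE.
Qed.

HB.instance Definition _ := Measure_isSigmaFinite.Build _ _ _ lebesgue_cons
  lebesgue_cons_sigma_finite.

End step.

Fixpoint borel_lebesgue_measure (n : nat) :
    {sigma_finite_measure set (rV_borel R n) -> \bar R} :=
  match n with
  | 0 => @dirac _ (rV_borel R 0) (0 : 'rV[R]_0) R
  | n'.+1 => lebesgue_cons (borel_lebesgue_measure n')
  end.

End product_lebesgue.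

Definition rV_lebesgue (R : realType) (n : nat) :=
  caratheodory_type ((borel_lebesgue_measure R n)^*)%mu.
HB.instance Definition _ (R : realType) (n : nat) :=
  Measurable.on (rV_lebesgue R n).

Definition lebesgue_rV (R : realType) (n : nat) :
    set (rV_lebesgue R n) -> \bar R :=
  @completed_measure_extension _ _ R (borel_lebesgue_measure R n).
HB.instance Definition _ (R : realType) (n : nat) :=
  Measure.on (@lebesgue_rV R n).

Section weights.
Variables (R : realType) (n : nat).
Local Notation Rn := (rV_lebesgue R n).
Local Notation mu := (@lebesgue_rV R n).
Local Open Scope ereal_scope.

Definition rV_locally_integrable (f : Rn -> \bar R) : Prop :=
  measurable_fun [set: Rn] f /\
  forall K : set 'rV[R]_n, compact K -> \int[mu]_(x in K) `|f x| < +oo.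

Definition weight (w : Rn -> \bar R) : Prop :=
  (\forall x \ae mu, 0 < w x) /\ rV_locally_integrable w.

Definition ae_infinite (v : Rn -> \bar R) : Prop := \forall x \ae mu, v x = +oo.

End weights.

Section condition_H.
Variables (R : realType) (n : nat).
Local Notation Rn := (rV_lebesgue R n).
Local Notation mu := (@lebesgue_rV R n).

Definition eucl_norm (x : 'rV[R]_n) : R := Num.sqrt (\sum_(i < n) x 0 i ^+ 2).

(* the norm of the library on 'rV[R]_n is the sup norm *)
Definition eucl_ball (c : 'rV[R]_n) (r : R) : set Rn :=
  [set y | eucl_norm (c - y) < r].

Local Open Scope ereal_scope.

(* [inve] satisfies +oo^-1 = 0, and [mule] satisfies 0 * +oo = 0, as required.
   The inverse of v is taken before the power p', because (+oo) `^ a = +oo in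
   the library even for a < 0. *)
Definition H_factor (m : nat) (p : \bar R) (g : R) (v : Rn -> \bar R)
    (c : 'rV[R]_n) (r : R) : \bar R :=
  let rho := (fine (mu (eucl_ball c r)) `^ n%:R^-1)%R in
  let a := (n%:R - g + m%:R^-1)%R in
  let den (y : Rn) := (rho + eucl_norm (c - y))%R in
  if p == 1 then 'N[mu]_+oo[(fun y => (v y)^-1 / (den y `^ a)%R%:E)]
  else let p' := fine (hoelder_conjugate p) in
    (\int[mu]_y ((v y)^-1 `^ p' / (den y `^ (a * p'))%R%:E)) `^ (p'^-1)%R.

Definition condition_H (m : nat) (p : 'I_m -> \bar R) (gamma delta : R)
    (w : Rn -> \bar R) (v : 'I_m -> Rn -> \bar R) : Prop :=
  exists g : 'I_m -> R,
    [/\ forall i, (0 < g i < n%:R)%R,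
        (\sum_(i < m) g i = gamma)%R &
        exists2 C : R, (0 < C)%R &
          forall (c : 'rV[R]_n) (r : R), (0 < r)%R ->
            let B := eucl_ball c r in
            mu B `^ (1 + (1 - delta) / n%:R)%R / (\int[mu]_(y in B) (w y)^-1)
              * \big[*%E/1]_(i < m) H_factor m (p i) (g i) (v i) c r <= C%:E].

End condition_H.

(* Main.v *)
Require Import Defs.
From HB Require Import structures.
From mathcomp Require Import all_boot all_order all_algebra.
From mathcomp Require Import all_classical all_reals all_analysis measurable_realfun.
From mathcomp Require Import ess_sup_inf ring lra.

Set Implicit Arguments.
Unset Strict Implicit.
Unset Printing Implicit Defensive.

Import Order.TTheory GRing.Theory Num.Theory.
Import numFieldNormedType.Exports.

Local Open Scope classical_set_scope.
Local Open Scope ring_scope.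

(** If some [v i] is infinite almost everywhere, its factor vanishes and, with
    [0 * +oo = 0], so does the whole product; [gamma / m] is an admissible choice
    of every [g i].

    Conversely, suppose that every [v i] is a weight.  Then [w^-1] and all the
    [v i] are locally integrable, and it suffices to test the condition on one
    sequence of small balls.  Starting from the unit cube, bisect repeatedly and
    always keep a child of least integral for [`|w^-1| + \sum_i `|v i|]
    ([nested_cubes]).  The averages of all these functions then stay below one
    constant [A] on every cube [Q k] of side [2 ^- k] of the chain, and the test
    ball of index [K] is the ball inscribed in [Q K.+1].

    On the test balls the weight quotient is at least a multiple of
    [h K `^ (1 - delta)], where [h K = 2 ^- K] ([weight_factor_ge]).  For the
    [i]-th factor, an upper bound on the average of [v i] bounds [(v i)^-1] below
    on a fixed proportion of each shell [Q k `\` Q k.+1] ([good_shell_ge]), at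
    distance at most a multiple of [2 ^- k] from the centre.  Summing over the
    shells [k <= K], or taking the supremum over the last one if [p i = 1], shows
    that the factor dominates [1], also [h K `^ (- theta i)]
    with [theta i = n - g i + 1 / m - n (1 - 1 / p i)], and a positive power of
    [K] when [theta i = 0] ([H_factor_ge_cst], [H_factor_ge_gain],
    [H_factor_ge_log]).

    Choosing a rate for each factor, the condition forces
    [delta - 1 + \sum_i e i <= 0] for all [e i] in [{0, theta i}], while
    [\sum_i theta i = n / p - gamma + 1].  Taking [e = 0] excludes [1 < delta] and
    [e = theta] excludes [gamma - n / p < delta].  If [delta = gamma - n / p = 1],
    the [theta i] add up to [0]: either one of them is positive, and that one
    alone is a contradiction, or all vanish, and the power of [K] in a single
    factor is unbounded ([condition_false]). *)

(** * Lebesgue measure of cubes *)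

(** Half-open, so that bisecting all the sides gives a genuine partition. *)
Definition cube (R : realType) (n : nat) (a : 'rV[R]_n) (s : R) :
    set 'rV[R]_n :=
  [set x | forall i, a 0 i <= x 0 i < a 0 i + s].

Lemma measurable_cube_borel (R : realType) (n : nat) (a : 'rV[R]_n) (s : R) :
  measurable (cube a s : set (rV_borel R n)).
Proof.
rewrite (_ : cube a s = \bigcap_(i in [set: 'I_n])
    ((fun x : rV_borel R n => x 0 i : measurableTypeR R) @^-1`
      `[a 0 i, a 0 i + s[)).
  apply: fin_bigcap_measurable => // i _; rewrite -[X in measurable X]setTI.
  by apply: measurable_rV_coord => //; exact: measurable_itv.
apply/seteqP; split => [x xc i _|x xc i] /=; first by rewrite in_itv/=.
by have := xc i I; rewrite /= in_itv.
Qed.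

Lemma borel_lebesgue_cube (R : realType) (n : nat) (a : 'rV[R]_n) (s : R) :
  0 <= s -> borel_lebesgue_measure R n (cube a s) = (s ^+ n)%:E.
Proof.
move=> s0; elim: n a => [a|n IHn a].
  by rewrite /= diracE mem_set// => -[].
rewrite /= /lebesgue_cons /pushforward.
rewrite (_ : _ @^-1` _ = `[a 0 ord0, a 0 ord0 + s[%classic `*`
    cube (\row_(k < n) a 0 (lift ord0 k)) s).
  rewrite product_measure1E//; last exact: measurable_cube_borel.
  rewrite IHn exprS EFinM; congr (_ * _)%E.
  transitivity ((@lebesgue_measure R) `[a 0 ord0, a 0 ord0 + s[%classic) => //.
  rewrite lebesgue_measure_itv/= lte_fin; case: ifPn => [_|].
    by rewrite -EFinB addrAC subrr add0r.
  by rewrite -leNgt gerDl => s_le0; rewrite (@le_anti _ _ s 0) ?s0 ?s_le0.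
apply/seteqP; split => [[x y] /= xy|[x y] /= [x_a y_a] i].
  split=> [|k]; first by have := xy ord0; rewrite mxE unlift_none in_itv.
  by have := xy (lift ord0 k); rewrite !mxE liftK.
case: (unliftP ord0 i) => [k ->|->]; last first.
  by move: x_a; rewrite mxE unlift_none /= in_itv.
by have := y_a k; rewrite !mxE liftK.
Qed.

Lemma borel_measurable_lebesgue (R : realType) (n : nat)
    (A : set (rV_borel R n)) :
  measurable A -> measurable (A : set (rV_lebesgue R n)).
Proof.
move=> mA; apply: (@sub_caratheodory _ _ _ (borel_lebesgue_measure R n)).
exact: sub_sigma_algebra.
Qed.

Lemma measurable_cube (R : realType) (n : nat) (a : 'rV[R]_n) (s : R) :
  measurable (cube a s : set (rV_lebesgue R n)).
Proof.
by apply: borel_measurable_lebesgue; exact: measurable_cube_borel.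
Qed.

Lemma lebesgue_cube (R : realType) (n : nat) (a : 'rV[R]_n) (s : R) :
  0 <= s -> lebesgue_rV (cube a s) = (s ^+ n)%:E.
Proof.
move=> s0; rewrite -(borel_lebesgue_cube a s0).
by apply: measurable_mu_extE; exact: measurable_cube_borel.
Qed.

(** Gives measurability of functions known only almost everywhere, such as a
    [v] that is infinite almost everywhere. *)
Lemma lebesgue_complete (R : realType) (n : nat) :
  measure_is_complete (@lebesgue_rV R n).
Proof. exact: measure_is_complete_caratheodory. Qed.

Lemma lebesgue_setT_gt0 (R : realType) (n : nat) :
  (0 < @lebesgue_rV R n [set: _])%E.
Proof.
apply: (@lt_le_trans _ _ (lebesgue_rV (cube (0 : 'rV[R]_n) 1))).
  by rewrite lebesgue_cube// expr1n.
by apply: le_measure => //; rewrite inE; [exact: measurable_cube|].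
Qed.

Lemma measurable_fun_borel_lebesgue (R : realType) (n : nat) d
    (T : measurableType d) (f : 'rV[R]_n -> T) :
  measurable_fun [set: rV_borel R n] f ->
  measurable_fun [set: rV_lebesgue R n] f.
Proof.
by move=> mf _ B mB; rewrite setTI; apply: borel_measurable_lebesgue;
  rewrite -[X in measurable X]setTI; exact: mf.
Qed.

Lemma compact_closed_cube (R : realType) (n : nat) (a b : R) :
  compact [set x : 'rV[R]_n | forall i, `[a, b]%classic (x 0 i)].
Proof.
by apply: (@rV_compact R n (fun=> `[a, b]%classic)) => i;
  exact: segment_compact.
Qed.

(** * Euclidean balls *)

Lemma eucl_norm_ge0 (R : realType) (n : nat) (x : 'rV[R]_n) :
  0 <= eucl_norm x.
Proof. exact: sqrtr_ge0. Qed.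

Lemma coord_le_eucl_norm (R : realType) (n : nat) (x : 'rV[R]_n) i :
  `|x 0 i| <= eucl_norm x.
Proof.
rewrite -sqrtr_sqr ler_sqrt; last by apply: sumr_ge0 => j _; exact: sqr_ge0.
by rewrite (bigD1 i)//= lerDl; apply: sumr_ge0 => j _; exact: sqr_ge0.
Qed.

Lemma eucl_norm_le (R : realType) (n : nat) (x : 'rV[R]_n) (t : R) :
  0 <= t -> (forall i, `|x 0 i| <= t) -> eucl_norm x <= n%:R * t.
Proof.
move=> t0 xt; have nt0 : 0 <= n%:R * t by rewrite mulr_ge0.
rewrite -[leRHS](ger0_norm nt0) -sqrtr_sqr ler_sqrt ?sqr_ge0//.
apply: (@le_trans _ _ (\sum_(i < n) t ^+ 2)).
  apply: ler_sum => i _; rewrite -real_normK ?num_real//.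
  by rewrite lerXn2r ?nnegrE.
rewrite sumr_const card_ord exprMn -[leLHS]mulr_natl ler_wpM2r ?sqr_ge0//.
by rewrite -natrX ler_nat; case: (n) => // k; rewrite expnS expn1 leq_pmulr.
Qed.

Lemma measurable_eucl_dist (R : realType) (n : nat) (c : 'rV[R]_n) :
  measurable_fun [set: rV_lebesgue R n] (fun y => eucl_norm (c - y)).
Proof.
apply: measurable_fun_borel_lebesgue.
apply: (@measurableT_comp _ _ _ _ _ _ (@Num.sqrt R)).
  apply: continuous_measurable_fun; exact: sqrt_continuous.
apply: measurable_sum => i; apply: measurable_funX.
rewrite (_ : (fun x => _) = (fun x : rV_borel R n => c 0 i - x 0 i)); last first.
  by apply/funext => x; rewrite !mxE.
by apply: measurable_funB => //; exact: measurable_rV_coord.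
Qed.

Lemma measurable_eucl_ball (R : realType) (n : nat) (c : 'rV[R]_n) (r : R) :
  measurable (eucl_ball c r).
Proof.
have := @measurable_eucl_dist R n c measurableT _ (measurable_itv `]-oo, r[).
by rewrite setTI; congr measurable; apply/seteqP; split => y /=; rewrite in_itv.
Qed.

Lemma eucl_ball_sub_cube (R : realType) (n : nat) (c : 'rV[R]_n) (r : R) :
  eucl_ball c r `<=` cube (\row_i (c 0 i - r)) (2 * r).
Proof.
move=> y /= cy i; have := le_lt_trans (coord_le_eucl_norm (c - y) i) cy.
by rewrite !mxE ltr_norml => /andP[? ?]; apply/andP; split; lra.
Qed.

Lemma cube_sub_eucl_ball (R : realType) (n : nat) (c : 'rV[R]_n) (r : R) :
  (0 < n)%N -> 0 < r ->
  cube (\row_i (c 0 i - r / (2 * n%:R))) (r / n%:R) `<=` eucl_ball c r.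
Proof.
move=> n0 r0 y /= cy; have n0' : 0 < n%:R :> R by rewrite ltr0n.
apply: (@le_lt_trans _ _ (n%:R * (r / (2 * n%:R)))); last first.
  have -> : n%:R * (r / (2 * n%:R)) = r / 2 by field; rewrite gt_eqF.
  by lra.
apply: eucl_norm_le => [|i]; first by rewrite divr_ge0// ?mulr_ge0// ltW.
have := cy i; rewrite !mxE ler_norml.
have -> : r / n%:R = 2 * (r / (2 * n%:R)) :> R.
  by field; rewrite gt_eqF.
by move: (r / (2 * n%:R)) => u /andP[? ?]; apply/andP; split; lra.
Qed.

Lemma lebesgue_eucl_ball_le (R : realType) (n : nat) (c : 'rV[R]_n) (r : R) :
  0 < r -> (lebesgue_rV (eucl_ball c r) <= ((2 * r) ^+ n)%:E)%E.
Proof.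
move=> r0; rewrite -(lebesgue_cube (\row_i (c 0 i - r))); last first.
  by rewrite mulr_ge0// ltW.
apply: le_measure; rewrite ?inE; last exact: eucl_ball_sub_cube.
- exact: measurable_eucl_ball.
- exact: measurable_cube.
Qed.

Lemma lebesgue_eucl_ball_ge (R : realType) (n : nat) (c : 'rV[R]_n) (r : R) :
  (0 < n)%N -> 0 < r ->
  (((r / n%:R) ^+ n)%:E <= lebesgue_rV (eucl_ball c r))%E.
Proof.
move=> n0 r0.
rewrite -(lebesgue_cube (\row_i (c 0 i - r / (2 * n%:R)))); last first.
  by rewrite divr_ge0// ltW.
apply: le_measure; rewrite ?inE; last exact: cube_sub_eucl_ball.
- exact: measurable_cube.
- exact: measurable_eucl_ball.
Qed.

(** * Nested dyadic cubes *)

Section nested_cubes.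
Variables (R : realType) (n : nat) (f : rV_lebesgue R n -> \bar R).
Local Notation mu := (@lebesgue_rV R n).
Hypotheses (mf : measurable_fun [set: _] f) (f0 : forall x, (0 <= f x)%E).

(** The [2 ^ n] children partition the cube, so a child of least integral has at
    most the mean of their integrals. *)
Lemma cube_halving (a : 'rV[R]_n) (s : R) :
  exists b : 'rV[R]_n, cube b (s / 2) `<=` cube a s /\
    ((2 ^ n)%:R%:E * \int[mu]_(x in cube b (s / 2)) f x <=
     \int[mu]_(x in cube a s) f x)%E.
Proof.
pose child (e : {ffun 'I_n -> bool}) : set (rV_lebesgue R n) :=
  cube (\row_i (a 0 i + s / 2 * (e i)%:R)) (s / 2).
have child_sub e : child e `<=` cube a s.
  move=> x xe i; have := xe i; rewrite mxE.
  by case: (e i) => /= /andP[? ?]; apply/andP; split; lra.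
have mchild e : measurable (child e) by exact: measurable_cube.
have [e _ e_min] := arg_minP (fun e => \int[mu]_(x in child e) f x)%E
  (erefl : xpredT [ffun=> false]).
exists (\row_i (a 0 i + s / 2 * (e i)%:R)); split; first exact: child_sub.
apply: (@le_trans _ _
    (\sum_(e' : {ffun 'I_n -> bool}) \int[mu]_(x in child e') f x)%E).
  apply: (@le_trans _ _
      (\sum_(e' : {ffun 'I_n -> bool}) \int[mu]_(x in child e) f x)%E).
    by rewrite sumr_const card_ffun card_bool card_ord mule_natl.
  by apply: lee_sum => e' _; exact: e_min.
rewrite -ge0_integral_bigsetU//.
- apply: ge0_subset_integral => //; first exact: bigsetU_measurable.
  + exact: measurable_cube.
  + exact: measurable_funTS.
  + by move=> x; rewrite -bigcup_seq => -[e' _]; exact: child_sub.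
- exact: index_enum_uniq.
- move=> e1 e2 _ _ [x [x1 x2]]; apply/ffunP => i.
  have := x1 i; have := x2 i; rewrite !mxE.
  by case: (e1 i); case: (e2 i) => //= /andP[? ?] /andP[? ?]; exfalso; lra.
- exact: measurable_funTS.
Qed.

(** An elementary substitute for Lebesgue's differentiation theorem: always
    descending to a child of least integral never increases the average of [f],
    so that the bound of the unit cube holds at every scale at once. *)
Lemma nested_cubes (A : R) :
  (\int[mu]_(x in cube (0 : 'rV[R]_n) 1) f x <= A%:E)%E ->
  exists a : nat -> 'rV[R]_n, forall k,
    cube (a k.+1) (2^-1 ^+ k.+1) `<=` cube (a k) (2^-1 ^+ k) /\
    (\int[mu]_(x in cube (a k) (2^-1 ^+ k)) f x <=
      (A * (2^-1 ^+ k) ^+ n)%:E)%E.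
Proof.
move=> fA.
have [next nextP] :=
  choice (fun q : 'rV[R]_n * R => cube_halving q.1 q.2).
pose a k := iteri k (fun j b => next (b, 2^-1 ^+ j)) 0.
have aS k : cube (a k.+1) (2^-1 ^+ k.+1) `<=` cube (a k) (2^-1 ^+ k) /\
    ((2 ^ n)%:R%:E * \int[mu]_(x in cube (a k.+1) (2^-1 ^+ k.+1)) f x <=
     \int[mu]_(x in cube (a k) (2^-1 ^+ k)) f x)%E.
  by rewrite exprSr; exact: (nextP (a k, 2^-1 ^+ k)).
exists a => k; split; first by have [] := aS k.
elim: k => [|k IHk]; first by rewrite expr0 expr1n mulr1.
have [_ aSk] := aS k; have := le_trans aSk IHk.
have n2 : 0 < (2 ^ n)%:R :> R by rewrite ltr0n expn_gt0.
rewrite -lee_pdivlMl// -EFinM; congr (_ <= _%:E)%E.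
by rewrite mulrCA natrX -exprVn -exprMn exprS.
Qed.

End nested_cubes.

(** * Lower bounds for the factors along nested cubes *)

Lemma measurable_inve (R : realType) :
  measurable_fun [set: \bar R] (fun x : \bar R => x^-1)%E.
Proof.
apply: (measurability _ (ErealGenOInfty.measurableE R)) => //.
move=> _ [_ [r ->] <-]; rewrite setTI.
have [r0|r0] := leP 0 r.
(* For r = 0 the right bound r^-1 is +oo, and +oo itself is rightly excluded. *)
- rewrite (_ : _ @^-1` _ = `[0%E, (r%:E^-1)%E[%classic).
    exact: emeasurable_itv.
  apply/seteqP; split => x /=; rewrite !in_itv/= andbT.
    move=> rx; have x0 : (0 <= x)%E.
      by rewrite -inve_ge0 (le_trans _ (ltW rx)).
    by rewrite x0/= -inve_pgt ?inE.
  by move=> /andP[x0 xr]; rewrite inve_pgt ?inE.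
- rewrite (_ : _ @^-1` _ = `[0%E, +oo[%classic `|` `]-oo%E, (r^-1)%:E[%classic).
    by apply: measurableU; exact: emeasurable_itv.
  apply/seteqP; split => x /=; rewrite !in_itv/= !andbT.
    have [x0 _|x0 rx] := leP 0%E x; [by left|right].
    move: x x0 rx => [x| |]//=; rewrite lte_fin => x0.
    rewrite inver lt_eqF// !lte_fin ltNyr/= => rx.
    by rewrite -(invrK x) ltf_nV2 ?negrE ?invr_lt0.
  move=> [x0|/andP[]].
    by rewrite (@lt_le_trans _ _ 0%E) ?inve_ge0.
  case: x => [x| |]// _; rewrite lte_fin => xr.
  have x0 : x < 0 by rewrite (lt_trans xr)// invr_lt0.
  by rewrite inver lt_eqF// lte_fin -(invrK r) ltf_nV2 ?negrE ?invr_lt0.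
Qed.

Lemma lee_inve_EFin (R : realType) (x : \bar R) (M : R) :
  0 < M -> (0 < x)%E -> (x <= M%:E)%E -> ((M^-1)%:E <= x^-1)%E.
Proof.
move=> M0 x0 xM; have <- : (M%:E^-1)%E = (M^-1)%:E.
  by rewrite inver gt_eqF.
by rewrite lee_pV2// inE ?lee_fin ltW.
Qed.

Lemma hoelder_conjugate_fine (R : realType) (p : \bar R) :
  (1 <= p)%E -> p != 1%E ->
  0 < fine (hoelder_conjugate p) /\
  (fine (hoelder_conjugate p))^-1 = 1 - fine p^-1%E.
Proof.
move: p => [r| |]//; last by rewrite hoelder_conjugatey invey/= subr0 invr1.
rewrite lee_fin eqe => r1 rn1.
have r_gt1 : 1 < r by rewrite lt_neqAle eq_sym rn1.
have r0 : r != 0 by rewrite gt_eqF// (lt_trans ltr01).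
have r1n0 : r - 1 != 0 by rewrite subr_eq0.
rewrite /hoelder_conjugate/= eqe (negbTE r0).
rewrite !inver/= (negbTE r1n0) (negbTE r0)/=; split.
  by rewrite divr_gt0 ?subr_gt0// (lt_trans ltr01).
by field; rewrite r0 r1n0.
Qed.

Section good_sets.
Variables (R : realType) (n : nat) (v : rV_lebesgue R n -> \bar R).
Variables (A : R) (a : nat -> 'rV[R]_n).
Local Notation mu := (@lebesgue_rV R n).
Local Notation h k := (2^-1 ^+ k : R).
Local Notation Q k := (cube (a k) (h k)).
Hypotheses (n_gt0 : (0 < n)%N) (A_gt0 : 0 < A).
Hypotheses (mv : measurable_fun [set: _] v).
Hypotheses (v_gt0 : \forall x \ae mu, (0 < v x)%E).
Hypothesis (Q_nested : forall k, Q k.+1 `<=` Q k).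
Hypothesis (Q_avg : forall k,
  (\int[mu]_(x in Q k) `|v x| <= (A * (h k) ^+ n)%:E)%E).

Let h_gt0 k : 0 < h k. Proof. by rewrite exprn_gt0// invr_gt0. Qed.

(** Removing the next cube makes these sets disjoint for different [k], so that
    their contributions to an integral add up; [4 * A] is large enough for them
    to keep a fixed proportion of the volume of [Q k]. *)
Definition good_shell k : set (rV_lebesgue R n) :=
  (Q k `\` Q k.+1) `&` [set x | (`|v x| < (4 * A)%:E)%E].

Lemma cube_nested j k : (j <= k)%N -> Q k `<=` Q j.
Proof.
move=> /subnK <-; elim: (k - j)%N => // i IH x; rewrite addSn => /Q_nested.
exact: IH.
Qed.

Let mQ k : measurable (Q k : set (rV_lebesgue R n)).
Proof. exact: measurable_cube. Qed.

Let mabs : measurable_fun [set: rV_lebesgue R n] (fun x => `|v x|)%E.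
Proof. exact: measurableT_comp. Qed.

Lemma measurable_good_shell k : measurable (good_shell k).
Proof.
apply: measurableI; first exact: measurableD.
have := emeasurable_fun_infty_o measurableT mabs (4 * A)%:E.
by rewrite setTI.
Qed.

Lemma trivIset_good_shell : trivIset setT good_shell.
Proof.
apply/trivIsetP => i j _ _; wlog ij : i j / (i < j)%N.
  move=> H; rewrite neq_ltn => /orP[/[dup] ij|/[dup] ij] /ltn_eqF.
    by move=> e; apply: H => //; rewrite e.
  by move=> e; rewrite setIC; apply: H => //; rewrite e.
move=> _; rewrite -subset0 => x [[[_ xi] _] [[xj _] _]].
by apply: xi; exact: (cube_nested ij).
Qed.

(** The shell has at least half of the volume of [Q k], and by Chebyshev's
    inequality [`|v|], whose average over [Q k] is at most [A], reaches [4 * A]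
    on at most a quarter of it. *)
Lemma good_shell_ge k : (((h k) ^+ n / 4)%:E <= mu (good_shell k))%E.
Proof.
have hn0 : 0 < (h k) ^+ n by rewrite exprn_gt0.
pose bad := Q k `&` [set x | ((4 * A)%:E <= `|v x|)%E].
have mbad : measurable (bad : set (rV_lebesgue R n)).
  have := emeasurable_fun_c_infty measurableT mabs (4 * A)%:E.
  by rewrite setTI => ?; apply: measurableI.
have bad_le : (mu bad <= ((h k) ^+ n / 4)%:E)%E.
  have A4 : 0 < 4 * A by rewrite mulr_gt0.
  have := le_integral_abse mu (mQ k) (measurable_funTS mv) A4.
  move=> /le_trans/(_ (Q_avg k)); rewrite -lee_pdivlMl//.
  move=> /le_trans; apply; rewrite -EFinM lee_fin.
  by rewrite le_eqVlt; apply/orP; left; apply/eqP; field; rewrite gt_eqF.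
have Q_le : (mu (Q k) <= mu (Q k.+1) + (mu bad + mu (good_shell k)))%E.
  have mg := measurable_good_shell k.
  apply: (@le_trans _ _ (mu (Q k.+1 `|` (bad `|` good_shell k)))).
    apply: le_measure; rewrite ?inE//; first by do ?apply: measurableU.
    move=> x xQ; have [xQ1|xQ1] := pselect (Q k.+1 x); [by left|right].
    by have [xv|xv] := leP (4 * A)%:E `|v x|%E; [left|right].
  apply: (le_trans (measureU2 _ _ _)) => //; first exact: measurableU.
  by rewrite leeD2l//; exact: measureU2.
rewrite !lebesgue_cube ?(ltW (h_gt0 _))// in Q_le.
have hS : (h k.+1) ^+ n <= (h k) ^+ n / 2.
  rewrite exprS exprMn mulrC ler_wpM2l ?(ltW hn0)//.
  by rewrite -[leRHS]expr1 ler_wiXn2l// ?invr_ge0// invf_le1// ler1n.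
have {}Q_le : (((h k) ^+ n)%:E <=
    ((h k) ^+ n / 2)%:E + (((h k) ^+ n / 4)%:E + mu (good_shell k)))%E.
  by apply: (le_trans Q_le); rewrite leeD ?lee_fin// leeD2r.
move: Q_le; case: (mu (good_shell k)) => [x| |]//=; rewrite ?leey//.
by rewrite -!EFinD !lee_fin; lra.
Qed.

Lemma ae_inve_ge_good_shell k :
  {ae mu, forall x, good_shell k x -> (((4 * A)^-1)%:E <= (v x)^-1)%E}.
Proof.
apply: filterS v_gt0 => x vx [_ /= v_lt]; apply: lee_inve_EFin => //.
  by rewrite mulr_gt0.
by rewrite ltW// (le_lt_trans _ v_lt)// lee_abs.
Qed.

Lemma integral_ge_good_shells (g : rV_lebesgue R n -> \bar R) (M : nat -> R)
    (K : nat) :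
  measurable_fun [set: _] g -> (forall x, (0 <= g x)%E) ->
  (forall k, 0 <= M k) ->
  (forall k, (k < K)%N ->
    {ae mu, forall x, good_shell k x -> ((M k)%:E <= g x)%E}) ->
  ((\sum_(k < K) M k * ((h k) ^+ n / 4))%:E <= \int[mu]_x g x)%E.
Proof.
move=> mg g0 M0 gM; have mE := measurable_good_shell.
pose D := \big[setU/set0]_(k <- index_iota 0 K) good_shell k.
apply: (@le_trans _ _ (\int[mu]_(x in D) g x)%E); last first.
  by apply: ge0_subset_integral => //; exact: bigsetU_measurable.
rewrite ge0_integral_bigsetU//; last 3 first.
- exact: iota_uniq.
- exact: sub_trivIset trivIset_good_shell.
- exact: measurable_funTS.
rewrite -sumEFin big_mkord; apply: lee_sum => k _.
apply: (@le_trans _ _ (\int[mu]_(x in good_shell k) (cst (M k)%:E) x)%E).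
  by rewrite integral_cst// EFinM lee_wpmul2l ?lee_fin//; exact: good_shell_ge.
apply: ae_ge0_le_integral => //.
- by move=> x _; rewrite /= lee_fin.
- exact: measurable_funTS.
- by apply: filterS (gM k (ltn_ord k)) => x xM /xM.
Qed.

Definition test_center k : 'rV[R]_n := \row_i (a k 0 i + h k / 2).

Lemma test_ball_sub k : eucl_ball (test_center k) (h k / 2) `<=` Q k.
Proof.
have -> : Q k = cube (\row_i (test_center k 0 i - h k / 2)) (2 * (h k / 2)).
  by congr cube; [apply/rowP => i; rewrite !mxE addrK|rewrite mulrC divfK].
exact: eucl_ball_sub_cube.
Qed.

(** The term [|B|^(1/n)] of the denominators, for the test ball [B]. *)
Definition rho k : R :=
  fine (mu (eucl_ball (test_center k) (h k / 2))) `^ n%:R^-1.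

Lemma test_ball_fine k :
  mu (eucl_ball (test_center k) (h k / 2)) =
    (fine (mu (eucl_ball (test_center k) (h k / 2))))%:E /\
  (h k / 2 / n%:R) ^+ n <= fine (mu (eucl_ball (test_center k) (h k / 2)))
    <= (h k) ^+ n.
Proof.
have r0 : 0 < h k / 2 by rewrite divr_gt0.
have := lebesgue_eucl_ball_le (test_center k) r0.
have := lebesgue_eucl_ball_ge (test_center k) n_gt0 r0.
case: (mu _) => [b| |]//=; rewrite !lee_fin => -> /=.
by rewrite mulrC divfK.
Qed.

Lemma rho_gt0 k : 0 < rho k.
Proof.
rewrite powR_gt0//; have [_ /andP[/(lt_le_trans _) + _]] := test_ball_fine k.
by apply; rewrite exprn_gt0// !divr_gt0// ltr0n.
Qed.

Lemma rho_le k : rho k <= h k.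
Proof.
have [_ /andP[b0 b_le]] := test_ball_fine k.
have hn0 : 0 <= (h k) ^+ n by rewrite exprn_ge0// ltW.
have -> : h k = ((h k) ^+ n) `^ n%:R^-1.
  rewrite -powR_mulrn ?(ltW (h_gt0 k))// -powRrM mulfV ?pnatr_eq0 -?lt0n//.
  by rewrite powRr1// ltW.
rewrite ge0_ler_powR ?nnegrE//.
by rewrite (le_trans _ b0)// exprn_ge0// !divr_ge0// ltW.
Qed.

Lemma den_gt0 k y : 0 < rho k + eucl_norm (test_center k - y).
Proof. by rewrite ltr_pwDl ?rho_gt0// eucl_norm_ge0. Qed.

(** The centre and [y] lie in a common cube of side [h j]; the radius of the
    ball is not larger. *)
Lemma den_le j k y : (j <= k)%N -> Q j y ->
  rho k + eucl_norm (test_center k - y) <= n.+1%:R * h j.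
Proof.
move=> jk yQ; rewrite -natr1 mulrDl mul1r addrC lerD//; last first.
  rewrite (le_trans (rho_le k))// ler_wiXn2l// ?invr_ge0//.
  by rewrite invf_le1// ler1n.
have cQ : Q j (test_center k).
  apply: (cube_nested jk) => i; rewrite mxE.
  by have := h_gt0 k; move: (h k) => u u0; apply/andP; split; lra.
apply: eucl_norm_le => [|i]; first exact: ltW.
have := cQ i; have := yQ i; rewrite !mxE ler_norml => /andP[? ?] /andP[? ?].
by apply/andP; split; lra.
Qed.

Lemma den_powR_le (e : R) j k y : 0 <= e -> (j <= k)%N -> Q j y ->
  (rho k + eucl_norm (test_center k - y)) `^ e <= (n.+1%:R * h j) `^ e.
Proof.
by move=> e0 jk yQ; rewrite ge0_ler_powR ?nnegrE ?den_le ?(ltW (den_gt0 _ _)).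
Qed.

End good_sets.

Definition dominates (R : realType) (F : nat -> \bar R) (G : nat -> R) :=
  exists2 kappa : R, 0 < kappa & forall K, ((kappa * G K)%:E <= F K)%E.

Section factor_bounds.
Variables (R : realType) (n : nat) (v : rV_lebesgue R n -> \bar R).
Variables (A : R) (a : nat -> 'rV[R]_n).
Local Notation mu := (@lebesgue_rV R n).
Local Notation h k := (2^-1 ^+ k : R).
Local Notation Q k := (cube (a k) (h k)).
Hypotheses (n_gt0 : (0 < n)%N) (A_gt0 : 0 < A).
Hypotheses (mv : measurable_fun [set: _] v).
Hypotheses (v_gt0 : \forall x \ae mu, (0 < v x)%E).
Hypothesis (Q_nested : forall k, Q k.+1 `<=` Q k).
Hypothesis (Q_avg : forall k,
  (\int[mu]_(x in Q k) `|v x| <= (A * (h k) ^+ n)%:E)%E).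
Variables (m : nat) (p : \bar R) (g : R).
Hypotheses (p_ge1 : (1 <= p)%E) (g_lt : g < n%:R).

Local Notation al := (n%:R - g + m%:R^-1).
(* The ball sits in Q K.+1, so that the shells of index up to K all surround it. *)
Local Notation factor K :=
  (H_factor m p g v (test_center a K.+1) (h K.+1 / 2)).

(** On the scale [h k], the [L^p'] norm of the kernel of exponent [al] has size
    [h k `^ (- al)] times [h k `^ (n / p')], which is [h k `^ (- gain)]. *)
Definition gain : R := al - n%:R * (1 - fine p^-1%E).

Let h_gt0 k : 0 < h k. Proof. by rewrite exprn_gt0// invr_gt0. Qed.

Let al_gt0 : 0 < al.
Proof. by rewrite ltr_wpDr ?invr_ge0// subr_gt0. Qed.

Let A4 : 0 < (4 * A)^-1. Proof. by rewrite invr_gt0 mulr_gt0. Qed.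

Lemma inve_den_ge (e : R) k K y : 0 <= e -> (k < K.+1)%N -> Q k y ->
  ((((n.+1%:R * h k) `^ e)^-1)%:E <=
    ((rho a K.+1 + eucl_norm (test_center a K.+1 - y)) `^ e)%:E^-1)%E.
Proof.
move=> e0 kK yQ; have d0 := den_gt0 a n_gt0 K.+1 y.
have de0 := powR_gt0 e d0.
have ne0 : 0 < (n.+1%:R * h k) `^ e by rewrite powR_gt0// mulr_gt0.
rewrite inver gt_eqF// lee_fin lef_pV2 ?posrE//.
by apply: den_powR_le => //; exact: ltnW.
Qed.

Lemma measurable_inve_den (e : R) K : measurable_fun [set: rV_lebesgue R n]
  (fun y => ((rho a K.+1 + eucl_norm (test_center a K.+1 - y)) `^ e)%:E^-1)%E.
Proof.
apply: (measurableT_comp (@measurable_inve R)); apply/measurable_EFinP.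
apply: (measurableT_comp (measurable_powR e)).
by apply: measurable_funD => //; exact: measurable_eucl_dist.
Qed.

(** Every shell contributes a bounded multiple of [h k `^ (- s * gain)], where
    [s] is the conjugate exponent; keeping them all is what detects the
    logarithmic divergence when [gain] vanishes. *)
Lemma H_factor_ge_sum : p != 1%E ->
  let s := fine (hoelder_conjugate p) in
  dominates (fun K => factor K)
    (fun K => (\sum_(k < K.+1) h k `^ (- (s * gain))) `^ s^-1).
Proof.
move=> pn1 s; have [s_gt0 sV] := hoelder_conjugate_fine p_ge1 pn1.
rewrite -/s in s_gt0 sV.
pose kappa := (4 * A)^-1 `^ s / (n.+1%:R `^ (al * s)) / 4.
have kappa_gt0 : 0 < kappa.
  by rewrite !divr_gt0 ?powR_gt0.
exists (kappa `^ s^-1); first exact: powR_gt0.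
move=> K; rewrite /H_factor (negbTE pn1) -/s -/(rho a K.+1).
have als : 0 <= al * s by rewrite mulr_ge0// ltW.
have sum_ge0 : 0 <= \sum_(k < K.+1) h k `^ (- (s * gain)).
  by apply: sumr_ge0 => k _; exact: powR_ge0.
rewrite -powRM ?(ltW kappa_gt0)// -poweR_EFin.
set I := (\int[_]_y _)%E.
have I_ge : ((kappa * \sum_(k < K.+1) h k `^ (- (s * gain)))%:E <= I)%E.
  pose M k := (4 * A)^-1 `^ s / (n.+1%:R * h k) `^ (al * s).
  rewrite (_ : _ * _ = \sum_(k < K.+1) M k * ((h k) ^+ n / 4)); last first.
    rewrite mulr_sumr; apply: eq_bigr => k _.
    have -> : - (s * gain) = n%:R - al * s.
      rewrite /gain -sV; have : s * s^-1 = 1 by rewrite mulfV ?gt_eqF.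
      by move: (s^-1) => t st; ring: st.
    rewrite powRD; last by apply/implyP => _; rewrite gt_eqF.
    rewrite powRN powR_mulrn ?(ltW (h_gt0 k))// /M powRM ?(ltW (h_gt0 k))//.
    by rewrite /kappa (invfM (n.+1%:R `^ _)); ring.
  apply: (integral_ge_good_shells n_gt0 A_gt0 mv Q_nested Q_avg).
  - apply: emeasurable_funM; last exact: measurable_inve_den.
    apply: (measurableT_comp (@measurable_poweR R s)).
    exact: (measurableT_comp (@measurable_inve R)).
  - move=> y; rewrite mule_ge0 ?poweR_ge0//.
    by rewrite inve_ge0 lee_fin powR_ge0.
  - by move=> k; rewrite divr_ge0 ?powR_ge0.
  move=> k kK; apply: filterS (ae_inve_ge_good_shell a A_gt0 v_gt0 k).
  move=> y yk yE; have {}yk := yk yE.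
  rewrite /M EFinM lee_pmul ?lee_fin ?invr_ge0 ?powR_ge0//.
    rewrite -poweR_EFin gt0_ler_poweR ?(ltW s_gt0)// in_itv/= leey andbT.
      by rewrite lee_fin ltW.
    by rewrite (le_trans _ yk)// lee_fin ltW.
  by apply: inve_den_ge => //; case: yE => -[].
apply: gt0_ler_poweR => //; first by rewrite invr_ge0 ltW.
- by rewrite in_itv/= leey lee_fin mulr_ge0// ltW.
- rewrite in_itv/= leey andbT (le_trans _ I_ge)//.
  by rewrite lee_fin mulr_ge0// ltW.
Qed.

(** If the essential supremum were smaller, [good_shell K] would be negligible,
    although its measure is positive. *)
Lemma H_factor1_ge : p = 1%E ->
  dominates (fun K => factor K) (fun K => h K `^ (- al)).
Proof.
move=> p1; pose kappa := (4 * A)^-1 / (n.+1%:R `^ al).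
have kappa_gt0 : 0 < kappa by rewrite divr_gt0 ?powR_gt0.
exists kappa => // K; rewrite /H_factor p1 eqxx -/(rho a K.+1).
rewrite unlock lebesgue_setT_gt0.
set f := (abse \o _); rewrite leNgt; apply/negP => f_lt.
have : mu.-negligible (good_shell v A a K).
  have [N [mN N0 NP]] : {ae mu, forall y, ~ good_shell v A a K y}.
    have fle := ess_sup_ge mu f.
    apply: filterS2 fle (ae_inve_ge_good_shell a A_gt0 v_gt0 K).
    move=> y yle yk yE; have {}yk := yk yE; move: f_lt; apply/negP.
    rewrite -leNgt (le_trans _ yle)//= (le_trans _ (lee_abs _))//.
    rewrite powRN /kappa.
    have -> : (4 * A)^-1 / n.+1%:R `^ al / h K `^ al =
        (4 * A)^-1 * ((n.+1%:R * h K) `^ al)^-1.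
      by rewrite powRM ?(ltW (h_gt0 K))// (invfM (n.+1%:R `^ _)) mulrA.
    rewrite EFinM lee_pmul ?lee_fin ?invr_ge0 ?powR_ge0 ?(ltW A4)//.
      by rewrite mulr_ge0// ltW.
    by apply: inve_den_ge; rewrite ?(ltW al_gt0)//; case: yE => -[].
  exists N; split => // y yE; apply: NP => /=; exact.
move/negligibleP => /(_ (measurable_good_shell A a mv K)) E0.
have := good_shell_ge n_gt0 A_gt0 mv Q_avg K.
suff : (0 < ((h K) ^+ n / 4)%:E :> \bar R)%E.
  by move=> /lt_le_trans h0 /h0; rewrite E0 ltxx.
by rewrite lte_fin divr_gt0// exprn_gt0.
Qed.

Let le_sum_h (e : R) K (k : 'I_K.+1) : h k `^ e <= \sum_(j < K.+1) h j `^ e.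
Proof.
by rewrite (bigD1 k)//= lerDl; apply: sumr_ge0 => j _; exact: powR_ge0.
Qed.

Let H_factor_ge_term (k : forall K, 'I_K.+1) : p != 1%E ->
  dominates (fun K => factor K) (fun K => h (k K) `^ (- gain)).
Proof.
move=> pn1; have [s_gt0 sV] := hoelder_conjugate_fine p_ge1 pn1.
have [kappa k0 kP] := H_factor_ge_sum pn1.
exists kappa => // K; apply: (le_trans _ (kP K)); rewrite lee_fin.
rewrite ler_wpM2l ?(ltW k0)//.
set s := fine _ in s_gt0 *.
have -> : - gain = - (s * gain) * s^-1.
  by rewrite mulNr mulrAC mulfV ?mul1r// gt_eqF.
rewrite powRrM ge0_ler_powR ?le_sum_h ?nnegrE ?invr_ge0 ?powR_ge0//.
  exact: ltW.
by apply: sumr_ge0 => j _; exact: powR_ge0.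
Qed.

(** The smallest shell, of index [K], is enough. *)
Lemma H_factor_ge_gain :
  dominates (fun K => factor K) (fun K => h K `^ (- gain)).
Proof.
have [p1|pn1] := eqVneq p 1%E; last exact: (H_factor_ge_term (@ord_max)).
have [kappa k0 kP] := H_factor1_ge p1; exists kappa => // K.
have -> : gain = al by rewrite /gain p1 inve1/= subrr mulr0 subr0.
exact: kP.
Qed.

(** For [p != 1] the largest shell, of index [0], is enough; for [p = 1] the rate
    [h K `^ (- al)] is itself at least [1]. *)
Lemma H_factor_ge_cst : dominates (fun K => factor K) (fun=> 1).
Proof.
have [p1|pn1] := eqVneq p 1%E.
  have [kappa k0 kP] := H_factor1_ge p1; exists kappa => // K.
  apply: (le_trans _ (kP K)); rewrite lee_fin ler_wpM2l ?(ltW k0)//.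
  rewrite powRN invf_ge1 ?powR_gt0//.
  have h1 : h K <= 1 by rewrite exprn_ile1 ?invr_ge0// invf_le1// ler1n.
  have := ge0_ler_powR (ltW al_gt0) (ltW (h_gt0 K) : h K \is Num.nneg)
    (ler01 : 1 \is Num.nneg) h1.
  by rewrite powR1.
have [kappa k0 kP] := H_factor_ge_term (@ord0) pn1; exists kappa => // K.
by have := kP K; rewrite expr0 powR1.
Qed.

(** [gain = 0] rules out [p = 1], for which [gain = n - g + 1 / m > 0]. Each of
    the [K.+1] shells now contributes the same amount to the integral. *)
Lemma H_factor_ge_log : gain = 0 ->
  exists2 e : R, 0 < e &
    dominates (fun K => factor K) (fun K => K.+1%:R `^ e).
Proof.
move=> gain0; have pn1 : p != 1%E.
  apply/eqP => p1; move: gain0 al_gt0; rewrite /gain p1 inve1/=.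
  by rewrite subrr mulr0 subr0 => ->; rewrite ltxx.
have [s_gt0 _] := hoelder_conjugate_fine p_ge1 pn1.
exists (fine (hoelder_conjugate p))^-1; first by rewrite invr_gt0.
have [kappa k0 kP] := H_factor_ge_sum pn1; exists kappa => // K.
apply: (le_trans _ (kP K)); rewrite gain0 mulr0 oppr0.
rewrite (eq_bigr (fun=> 1)) => [|k _]; last by rewrite powRr0.
by rewrite sumr_const card_ord.
Qed.

End factor_bounds.

(** * The weight factor and the degenerate case *)

Lemma le_integral_abs_subset d (T : measurableType d) (R : realType)
    (mu : {measure set T -> \bar R}) (D E : set T) (f : T -> \bar R) :
  measurable D -> measurable E -> measurable_fun [set: T] f -> D `<=` E ->
  (\int[mu]_(x in D) `|f x| <= \int[mu]_(x in E) `|f x|)%E.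
Proof.
move=> mD mE mf DE; apply: ge0_subset_integral => //.
by apply: measurable_funTS; exact: measurableT_comp.
Qed.

Lemma integral_ge0_abs d (T : measurableType d) (R : realType)
    (mu : {measure set T -> \bar R}) (D : set T) (f : T -> \bar R) :
  measurable D -> measurable_fun [set: T] f ->
  (\forall x \ae mu, (0 <= f x)%E) ->
  (\int[mu]_(x in D) f x = \int[mu]_(x in D) `|f x|)%E.
Proof.
move=> mD mf f0; apply: ae_eq_integral => //; first exact: measurable_funTS.
  by apply: measurable_funTS; exact: measurableT_comp.
by apply: filterS f0 => x fx _; rewrite gee0_abs.
Qed.

Lemma integral_abs_sum_lty d (T : measurableType d) (R : realType)
    (mu : {measure set T -> \bar R}) (D : set T) (I : finType)
    (u : I -> T -> \bar R) :
  measurable D -> (forall i, measurable_fun [set: T] (u i)) ->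
  (forall i, (\int[mu]_(x in D) `|u i x| < +oo)%E) ->
  (\int[mu]_(x in D) (\sum_(i : I) `|u i x|) < +oo)%E.
Proof.
move=> mD mu_ u_lty; rewrite ge0_integral_sum//.
  by apply: lte_sum_pinfty => i _; exact: u_lty.
by move=> i; apply: measurable_funTS; exact: measurableT_comp.
Qed.

Lemma le_integral_abs_sum d (T : measurableType d) (R : realType)
    (mu : {measure set T -> \bar R}) (D : set T) (I : finType)
    (u : I -> T -> \bar R) i :
  measurable D -> (forall i, measurable_fun [set: T] (u i)) ->
  (\int[mu]_(x in D) `|u i x| <=
   \int[mu]_(x in D) (\sum_(i : I) `|u i x|))%E.
Proof.
move=> mD mu_.
have mau j : measurable_fun [set: T] (fun x => `|u j x|)%E.
  exact: measurableT_comp.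
apply: ge0_le_integral => //.
- exact: measurable_funTS.
- by apply: measurable_funTS; exact: emeasurable_sum.
- by move=> x _; rewrite (bigD1 i)//= leeDl// sume_ge0.
Qed.

Section common_cubes.
Variables (R : realType) (n : nat).
Local Notation Rn := (rV_lebesgue R n).
Local Notation mu := (@lebesgue_rV R n).
Local Notation h k := (2^-1 ^+ k : R).

Lemma locally_integrable_cube (f : Rn -> \bar R) :
  rV_locally_integrable f ->
  (\int[mu]_(x in cube (0 : 'rV[R]_n) 1) `|f x| < +oo)%E.
Proof.
move=> [mf /(_ _ (@compact_closed_cube R n 0 1))]; apply: le_lt_trans.
apply: le_integral_abs_subset mf _.
- exact: measurable_cube.
- apply: borel_measurable_lebesgue.
  rewrite (_ : mkset _ = \bigcap_(i in [set: 'I_n])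
    ((fun x : rV_borel R n => x 0 i : measurableTypeR R) @^-1` `[0, 1])).
    apply: fin_bigcap_measurable => // i _; rewrite -[X in measurable X]setTI.
    by apply: measurable_rV_coord => //; exact: measurable_itv.
  by apply/seteqP; split => [x xc i _|x xc i]; exact: xc.
- move=> x xc i; have := xc i; rewrite mxE add0r /= in_itv/=.
  by move=> /andP[-> /ltW].
Qed.

(** Applied to the sum of the functions, the selection of cubes controls each of
    them along the same chain. *)
Lemma common_nested_cubes (I : finType) (u : I -> Rn -> \bar R) :
  (forall i, rV_locally_integrable (u i)) ->
  exists2 A : R, 0 < A & exists2 a : nat -> 'rV[R]_n,
    forall k, cube (a k.+1) (h k.+1) `<=` cube (a k) (h k) &
    forall i k, (\int[mu]_(x in cube (a k) (h k)) `|u i x| <=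
      (A * (h k) ^+ n)%:E)%E.
Proof.
move=> iu; pose f (x : Rn) := (\sum_(i : I) `|u i x|)%E.
have mu_ i : measurable_fun [set: Rn] (u i) by have [] := iu i.
have mf : measurable_fun [set: Rn] f.
  apply: emeasurable_sum => i.
  exact: (measurableT_comp (@abse_measurable R setT) (mu_ i)).
have f0 x : (0 <= f x)%E by exact: sume_ge0.
have mQ a s := @measurable_cube R n a s.
have f_fin : (\int[mu]_(x in cube (0 : 'rV[R]_n) 1) f x < +oo)%E.
  apply: (integral_abs_sum_lty (mQ _ _) mu_) => i.
  exact: locally_integrable_cube.
have If0 : (0 <= \int[mu]_(x in cube (0 : 'rV[R]_n) 1) f x)%E.
  exact: integral_ge0.
pose A := fine (\int[mu]_(x in cube (0 : 'rV[R]_n) 1) f x) + 1.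
have [|a aP] := @nested_cubes R n f mf f0 A.
  by rewrite EFinD fineK ?ge0_fin_numE// leeDl.
exists A; first by rewrite ltr_wpDl// fine_ge0.
exists a => [k|i k]; first by have [] := aP k.
have [_] := aP k; apply: le_trans.
exact: (le_integral_abs_sum mu i (mQ _ _) mu_).
Qed.

(** The constant depends on [l] and [e] only; the case split is there because a
    negative power reverses the inequalities. *)
Lemma powR_ge_of_between (l x b e : R) : 0 < l -> 0 < x ->
  l * x <= b <= x -> (if 0 <= e then l `^ e else 1) * x `^ e <= b `^ e.
Proof.
move=> l0 x0 /andP[lb bx]; have b0 : 0 < b.
  by rewrite (lt_le_trans _ lb)// mulr_gt0.
case: (leP 0 e) => e0 /=.
  rewrite -powRM ?(ltW l0) ?(ltW x0)// ge0_ler_powR ?nnegrE ?(ltW b0)//.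
  by rewrite mulr_ge0 ?ltW.
rewrite mul1r -(opprK e) !(powRN _ (- e)) lef_pV2 ?posrE ?powR_gt0//.
by rewrite ge0_ler_powR ?nnegrE ?oppr_ge0 ?(ltW e0) ?(ltW b0) ?(ltW x0).
Qed.

(** The ball has volume comparable to [h K ^+ n], and the integral of [w^-1] over
    it is at most that over the surrounding cube, again [O(h K ^+ n)]. *)
Lemma weight_factor_ge (w : Rn -> \bar R) (A delta : R) (a : nat -> 'rV[R]_n) :
  (0 < n)%N -> 0 < A -> (\forall x \ae mu, (0 < w x)%E) ->
  measurable_fun [set: Rn] (fun x => (w x)^-1)%E ->
  (forall k, (\int[mu]_(x in cube (a k) (h k)) `|(w x)^-1| <=
      (A * (h k) ^+ n)%:E)%E) ->
  dominates (fun K =>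
      mu (eucl_ball (test_center a K.+1) (h K.+1 / 2))
          `^ (1 + (1 - delta) / n%:R)%R
        / \int[mu]_(y in eucl_ball (test_center a K.+1) (h K.+1 / 2))
            (w y)^-1)%E
    (fun K => h K `^ (1 - delta)).
Proof.
move=> n0 A0 w0 mw wA; set e := 1 + (1 - delta) / n%:R.
have n0' : 0 < n%:R :> R by rewrite ltr0n.
pose l : R := (2 * n%:R)^-1 ^+ n.
have l0 : 0 < l by rewrite exprn_gt0// invr_gt0 mulr_gt0.
pose kl := if 0 <= e then l `^ e else 1.
have kl0 : 0 < kl by rewrite /kl; case: ifP => // _; rewrite powR_gt0.
exists (kl / A * 2^-1 `^ (1 - delta)).
  by rewrite mulr_gt0 ?divr_gt0// powR_gt0// invr_gt0.
move=> K; set B := eucl_ball _ _; set t := h K.+1.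
have t0 : 0 < t by rewrite exprn_gt0// invr_gt0.
have tn0 : 0 < t ^+ n by rewrite exprn_gt0.
have mB : measurable B by exact: measurable_eucl_ball.
have [-> b_bnd] := test_ball_fine a n0 K.+1; rewrite -/B -/t in b_bnd *.
set b := fine _ in b_bnd *.
have wV0 : \forall x \ae mu, (0 <= (w x)^-1)%E.
  by apply: filterS w0 => x wx; rewrite inve_ge0 ltW.
have IB_eq : (\int[mu]_(y in B) (w y)^-1 = \int[mu]_(y in B) `|(w y)^-1|)%E.
  exact: (integral_ge0_abs mB mw wV0).
have IB_ge0 : (0 <= \int[mu]_(y in B) (w y)^-1)%E.
  by rewrite IB_eq; exact: integral_ge0.
have IB_le : (\int[mu]_(y in B) (w y)^-1 <= (A * t ^+ n)%:E)%E.
  rewrite IB_eq; apply: le_trans (wA K.+1).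
  apply: (le_integral_abs_subset mu mB (measurable_cube _ _) mw).
  exact: test_ball_sub.
have At0 : 0 < A * t ^+ n by rewrite mulr_gt0.
have V_ge : (((A * t ^+ n)^-1)%:E <= (\int[mu]_(y in B) (w y)^-1)^-1)%E.
  have <- : ((A * t ^+ n)%:E^-1)%E = ((A * t ^+ n)^-1)%:E.
    by rewrite inver gt_eqF.
  by rewrite lee_pV2// inE lee_fin ltW.
have b_ge : kl * (t ^+ n) `^ e <= b `^ e.
  apply: powR_ge_of_between => //; move: b_bnd => /andP[+ ->]; rewrite andbT.
  by apply: le_trans; rewrite /l -exprMn mulrC -mulrA invfM.
have te : (t ^+ n) `^ e = t ^+ n * t `^ (1 - delta).
  rewrite -{1}powR_mulrn ?(ltW t0)// -powRrM.
  have -> : n%:R * e = n%:R + (1 - delta).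
    by rewrite /e mulrDr mulr1 mulrCA mulfV ?mulr1// gt_eqF.
  rewrite powRD; last by apply/implyP => _; rewrite gt_eqF.
  by rewrite powR_mulrn ?(ltW t0).
have te' : t `^ (1 - delta) = 2^-1 `^ (1 - delta) * h K `^ (1 - delta).
  by rewrite /t exprS powRM// ?invr_ge0// exprn_ge0// invr_ge0.
apply: (@le_trans _ _ ((kl * (t ^+ n) `^ e)%:E * ((A * t ^+ n)^-1)%:E)%E).
  rewrite -EFinM lee_fin te te' invfM.
  rewrite le_eqVlt; apply/orP; left; apply/eqP.
  move: (_ `^ _) (h K `^ _) => x y; move: (t ^+ n) tn0 => z z0.
  by field; rewrite !gt_eqF.
rewrite poweR_EFin lee_pmul// lee_fin.
- by rewrite mulr_ge0 ?powR_ge0// ltW.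
- by rewrite invr_ge0 ltW.
Qed.

Lemma H_factor_ae_infinite (m : nat) (p : \bar R) (g : R) (v : Rn -> \bar R)
    (c : 'rV[R]_n) (r : R) :
  (1 <= p)%E -> ae_infinite v -> H_factor m p g v c r = 0%E.
Proof.
move=> p1 vy; rewrite /H_factor; case: eqVneq => [_|pn1].
  rewrite unlock lebesgue_setT_gt0; apply: ess_sup_ae_cst.
    exact: lebesgue_setT_gt0.
  by apply: filterS vy => x /= ->; rewrite invey mul0e abse0.
have [s0 _] := hoelder_conjugate_fine p1 pn1.
set s := fine (hoelder_conjugate p) in s0 *.
set F := (X in (\int[_]_y X y)%E).
have F0 : ae_eq mu setT (cst 0%E) F.
  apply: filterS vy => x /= vx _.
  by rewrite /F vx invey poweR0r ?mul0e// gt_eqF.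
have mF := ae_measurable_fun (@lebesgue_complete R n) F0 (measurable_cst _).
have -> : (\int[mu]_y F y = 0)%E.
  rewrite -(integral0 mu setT); apply: ae_eq_integral => //.
  by apply: filterS F0 => x /[apply].
by rewrite poweR0r// invr_neq0// gt_eqF.
Qed.

End common_cubes.

(** * Comparison of the growth rates *)

Lemma half_powR_bounded (R : realType) (x C : R) :
  (forall K : nat, (2^-1 ^+ K) `^ x <= C) -> 0 <= x.
Proof.
move=> xC; rewrite leNgt; apply/negP => x0.
have l2 : 0 < - x * ln 2 by rewrite mulr_gt0 ?oppr_gt0// ln_gt0 ?ltr1n.
pose K := Num.bound (C / (- x * ln 2)).
have := xC K; apply/negP; rewrite -ltNge.
apply: (@lt_le_trans _ _ (1 + K%:R * (- x * ln 2))).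
  have C0 : 0 <= C by have := xC 0%N; rewrite expr0 powR1; apply: le_trans.
  by rewrite ltr_pwDl// -ler_pdivrMr// ltW// archi_boundP// divr_ge0// ltW.
rewrite (le_trans (expR_ge1Dx _))// /powR gt_eqF ?exprn_gt0 ?invr_gt0//.
rewrite lnXn ?invr_gt0// lnV ?posrE// -mulr_natl.
by rewrite le_eqVlt; apply/orP; left; apply/eqP; congr expR; ring.
Qed.

Lemma nat_powR_unbounded (R : realType) (e C : R) :
  0 < e -> ~ (forall K : nat, K.+1%:R `^ e <= C).
Proof.
move=> e0 eC; have C1 : 1 <= C by have := eC 0%N; rewrite powR1.
pose K := Num.bound (C `^ e^-1).
have CK : C `^ e^-1 < K.+1%:R.
  rewrite (lt_le_trans (archi_boundP _)) ?powR_ge0//.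
  by rewrite ler_nat.
have C0 : 0 <= C by rewrite (le_trans _ C1).
have := eC K; apply/negP; rewrite -ltNge.
have -> : C = (C `^ e^-1) `^ e by rewrite -powRrM mulVf ?powRr1// gt_eqF.
by rewrite gt0_ltr_powR ?nnegrE ?powR_ge0.
Qed.

Lemma prod_EFin_le (R : realType) (I : finType) (x : I -> R) (F : I -> \bar R) :
  (forall i, 0 <= x i) -> (forall i, ((x i)%:E <= F i)%E) ->
  ((\prod_i x i)%:E <= \big[*%E/1%E]_i F i)%E.
Proof.
move=> x0 xF; rewrite -prodEFin.
have /andP[] // : (0 <= \big[*%E/1%E]_i (x i)%:E <= \big[*%E/1%E]_i F i)%E.
elim/big_rec2: _ => [|i y z _ /andP[z0 zy]]; first by rewrite lee01 lexx.
by rewrite mule_ge0 ?lee_fin//= lee_pmul ?lee_fin.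
Qed.

Section necessity.
Variables (R : realType) (m n : nat) (gamma delta : R) (p : 'I_m -> \bar R).
Variables (w : rV_lebesgue R n -> \bar R) (v : 'I_m -> rV_lebesgue R n -> \bar R).
Local Notation mu := (@lebesgue_rV R n).
Local Notation h k := (2^-1 ^+ k : R).
Hypotheses (m_gt0 : (0 < m)%N) (n_gt0 : (0 < n)%N).
Hypotheses (p_ge1 : forall i, (1 <= p i)%E) (w_weight : weight w).
Hypothesis (w_inve : rV_locally_integrable (fun x => (w x)^-1)%E).
Hypothesis (v_weight : forall i, weight (v i)).
Hypothesis (vH : condition_H p gamma delta w v).

(** Everything that the condition says about the test balls, stripped of the
    measure theory: a product of growth rates is bounded, and each factor may
    be estimated by whichever of its rates is convenient. *)
Lemma condition_growth : exists (theta : 'I_m -> R) (F : 'I_m -> nat -> \bar R),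
  [/\ \sum_(i < m) theta i = n%:R * (\sum_(i < m) fine (p i)^-1%E) - gamma + 1,
    forall i, dominates (F i) (fun=> 1),
    forall i, dominates (F i) (fun K => h K `^ (- theta i)),
    forall i, theta i = 0 ->
      exists2 e, 0 < e & dominates (F i) (fun K => K.+1%:R `^ e) &
    forall G : 'I_m -> nat -> R, (forall i K, 0 <= G i K) ->
      (forall i, dominates (F i) (G i)) ->
      exists C, forall K, h K `^ (1 - delta) * \prod_(i < m) G i K <= C].
Proof.
have [g [g_bnd g_sum [C C0 HC]]] := vH.
(* None stands for w^-1, so that one chain of cubes serves all functions *)
pose u (j : option 'I_m) := if j is Some i then v i else fun x => (w x)^-1%E.
have u_int j : rV_locally_integrable (u j).
  by case: j => [i|//]; have [] := v_weight i.
have [A A0 [a a_nested a_avg]] := common_nested_cubes u_int.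
have v_avg i := a_avg (Some i); have w_avg := a_avg None.
have mv i : measurable_fun setT (v i) by have [_ []] := v_weight i.
have v0 i := (v_weight i).1.
have g_lt i : g i < n%:R by have /andP[] := g_bnd i.
exists (fun i => gain n m (p i) (g i)).
exists (fun i K => H_factor m (p i) (g i) (v i) (test_center a K.+1)
  (h K.+1 / 2)).
split.
- rewrite (eq_bigr (fun i => n%:R * fine (p i)^-1%E - g i + m%:R^-1)); last first.
    by move=> i _; rewrite /gain; ring.
  rewrite !big_split/= -mulr_sumr sumrN g_sum sumr_const card_ord.
  by rewrite -[m%:R^-1 *+ m]mulr_natl mulfV// pnatr_eq0 -lt0n.
- move=> i; exact: (H_factor_ge_cst n_gt0 A0 (mv i) (v0 i) a_nested (v_avg i)).
- move=> i; exact: (H_factor_ge_gain n_gt0 A0 (mv i) (v0 i) a_nested (v_avg i)).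
- move=> i; exact: (H_factor_ge_log n_gt0 A0 (mv i) (v0 i) a_nested (v_avg i)).
move=> G G0 FG.
have [k0 k0_gt0 k0P] := weight_factor_ge delta n_gt0 A0 w_weight.1 w_inve.1 w_avg.
have /choice[k kP] : forall i, exists ki : R, 0 < ki /\ forall K,
    ((ki * G i K)%:E <= H_factor m (p i) (g i) (v i) (test_center a K.+1)
      (h K.+1 / 2))%E.
  by move=> i; have [ki ki0 kiP] := FG i; exists ki.
have kk0 : 0 < k0 * \prod_(i < m) k i.
  by rewrite mulr_gt0//; apply: prodr_gt0 => i _; have [] := kP i.
exists (C / (k0 * \prod_(i < m) k i)) => K.
have r0 : 0 < h K.+1 / 2 by rewrite divr_gt0// exprn_gt0// invr_gt0.
have := HC (test_center a K.+1) _ r0.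
rewrite ler_pdivlMr// => HK; rewrite -lee_fin; apply: le_trans HK.
rewrite [leLHS](_ : _ = (k0 * h K `^ (1 - delta))%:E *
    (\prod_(i < m) (k i * G i K))%:E)%E; last first.
  by rewrite -EFinM big_split/=; congr EFin; ring.
have kG0 i : 0 <= k i * G i K by rewrite mulr_ge0//; have [/ltW] := kP i.
apply: lee_pmul; rewrite ?lee_fin//.
- by rewrite mulr_ge0 ?powR_ge0// ltW.
- by apply: prodr_ge0.
- by apply: prod_EFin_le => // i; have [_ ] := kP i.
Qed.

(** [rate] is the whole content of the condition for power rates; the last case,
    where it is not contradictory, needs the logarithmic one. *)
Lemma condition_false :
  let S := n%:R * \sum_(i < m) fine (p i)^-1%E in
  [\/ 1 < delta, gamma - S < delta | delta = gamma - S /\ delta = 1] -> False.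
Proof.
move=> S; have [theta [F [sum_theta F1 Ftheta Flog FG]]] := condition_growth.
rewrite -/S in sum_theta.
have rate (e : 'I_m -> R) : (forall i, e i = 0 \/ e i = theta i) ->
    0 <= 1 - delta - \sum_(i < m) e i.
  move=> eP; have [||C CP] := FG (fun i K => h K `^ (- e i)).
  - by move=> i K; exact: powR_ge0.
  - move=> i; have [->|->] := eP i; last exact: Ftheta.
    have [k k0 kP] := F1 i; exists k => // K.
    by rewrite oppr0 powRr0; exact: kP.
  apply: (@half_powR_bounded _ _ C) => K; apply: le_trans (CP K).
  have h0 : h K != 0 by rewrite expf_neq0// invr_neq0.
  rewrite powRD; last by rewrite h0 implybT.
  rewrite -sumrN (big_morph (powR (h K)) (id1 := 1) (op1 := *%R))//.
  + by move=> x y; rewrite powRD// h0 implybT.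
  + by rewrite powRr0.
case=> [d1|dS|[dS d1]].
- by have := rate (fun=> 0) (fun=> or_introl erefl); rewrite big1//; lra.
- by have := rate theta (fun=> or_intror erefl); rewrite sum_theta; lra.
(* A single positive theta j, all the other exponents being 0, would violate
   rate since 1 - delta = 0. *)
have theta_le0 j : theta j <= 0.
  pose e i := if i == j then theta j else 0.
  have := rate e; rewrite (bigD1 j)//= big1 => [|i /negbTE ij]; last first.
    by rewrite /e ij.
  rewrite /e eqxx d1 subrr addr0 sub0r oppr_ge0; apply => i.
  by case: eqP => [->|_]; [right|left].
have theta0 i : theta i = 0.
  have : \sum_(i < m) - theta i = 0.
    by rewrite sumrN sum_theta; lra.
  move=> /eqP; rewrite psumr_eq0 => [|j _]; last by rewrite oppr_ge0.
  by move=> /allP/(_ i); rewrite mem_index_enum oppr_eq0 => /(_ isT)/eqP.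
have j : 'I_m := Ordinal m_gt0.
have [e e0 Fj] := Flog j (theta0 j).
have [||C CP] := FG (fun i K => if i == j then K.+1%:R `^ e else 1).
- by move=> i K; case: ifP => // _; exact: powR_ge0.
- by move=> i; case: eqP => [->|_].
apply: (nat_powR_unbounded e0) => K; apply: le_trans (CP K).
by rewrite d1 subrr powRr0 mul1r (bigD1 j)//= eqxx big1 ?mulr1// => i /negbTE ->.
Qed.

End necessity.

(** * The theorem *)

Lemma condition_of_ae_infinite (R : realType) (m n : nat) (gamma delta : R)
    (p : 'I_m -> \bar R) (w : rV_lebesgue R n -> \bar R)
    (v : 'I_m -> rV_lebesgue R n -> \bar R) i :
  0 < gamma < (m * n)%:R -> (forall i, (1 <= p i)%E) ->
  ae_infinite (v i) -> condition_H p gamma delta w v.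
Proof.
move=> /andP[gamma0 gamma_lt] p1 vi.
have m0 : 0 < m%:R :> R by rewrite ltr0n (leq_ltn_trans _ (ltn_ord i)).
exists (fun=> gamma / m%:R); split.
- by move=> _; rewrite divr_gt0//= ltr_pdivrMr// -natrM mulnC.
- by rewrite sumr_const card_ord -[LHS]mulr_natr divfK// gt_eqF.
exists 1 => // c r r0 /=.
by rewrite (bigD1 i)//= H_factor_ae_infinite// mul0e mule0.
Qed.

Theorem theorem1p2 (R : realType) (m n : nat) (hm : (0 < m)%N) (hn : (0 < n)%N)
    (gamma delta : R) (hgamma : 0 < gamma < (m * n)%:R)
    (p : 'I_m -> \bar R) (hp : forall i, (1 <= p i)%E)
    (q : \bar R) (hq : (q^-1 = \sum_(i < m) (p i)^-1)%E)
    (w : rV_lebesgue R n -> \bar R) (hw : weight w)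
    (hwV : rV_locally_integrable (fun x => (w x)^-1)%E)
    (v : 'I_m -> rV_lebesgue R n -> \bar R)
    (hv : forall i, weight (v i) \/ ae_infinite (v i)) :
  ((1 < delta \/ (gamma%:E - n%:R%:E / q < delta%:E)%E) ->
     (condition_H p gamma delta w v <-> exists i, ae_infinite (v i)))
  /\
  ((delta%:E = gamma%:E - n%:R%:E / q)%E /\ delta = 1 ->
     (condition_H p gamma delta w v <-> exists i, ae_infinite (v i))).
Proof.
Proof.
pose S := n%:R * \sum_(i < m) fine (p i)^-1%E.
have qS : (n%:R%:E / q = S%:E)%E.
  rewrite hq EFinM -sumEFin; congr (_ * _)%E; apply: eq_bigr => i _.
  rewrite fineK//; have := hp i; case: (p i) => [r| |]//.
  rewrite lee_fin inver => r1.
  by rewrite gt_eqF// (lt_le_trans ltr01).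
have nec : [\/ 1 < delta, gamma - S < delta | delta = gamma - S /\ delta = 1] ->
    condition_H p gamma delta w v <-> exists i, ae_infinite (v i).
  move=> cases; split=> [H|[i vi]]; last first.
    exact: (condition_of_ae_infinite _ _ hgamma hp vi).
  apply: contrapT => no_inf; have v_weight i : weight (v i).
    by have [//|vi] := hv i; case: no_inf; exists i.
  exact: (condition_false hm hn hp hw hwV v_weight H cases).
rewrite qS -EFinB; split => [[d1|]|[]].
- by apply: nec; apply: Or31.
- by rewrite lte_fin => dS; apply: nec; apply: Or32.
- by move=> [dS] d1; apply: nec; apply: Or33.
Qed.
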